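(* Let $(F_1,\|\cdot\|_1)$ be a normed space of integrable univariate functions over a Borel set $D_1\subseteq\mathbb{R}$ and, for $d\in\mathbb{N}$, let $(F_d,\|\cdot\|_d)$ be the $d$-fold tensor product space equipped with a crossnorm $\|\cdot\|_d$. Assume that there exists $q\in[1,\infty]$ such that for all $d\in\mathbb{N}$ the norm $\|\cdot\|_d$ has the $q$-property: for any two functions $f,g\in F_d$ with disjoint support, $\|f+g\|_d^q=\|f\|_d^q+\|g\|_d^q$ if $q<\infty$, and $\|f+g\|_d=\max(\|f\|_d,\|g\|_d)$ if $q=\infty$. Assume that in $F_1$ there exists a worst-case function $h_1$ (with $h_d(x_1,\dots,x_d)=\prod_{j=1}^dh_1(x_j)$ a worst-case function in $F_d$ for every $d$) which can be decomposed as $h_1=h_{1,(0)}+h_{1,(1)}$ on $D_1$ such that: (D1) $h_{1,(0)},h_{1,(1)}\in F_1$; (D2) there is $a\in\mathbb{R}$ such that $D_{(0)}:=\{x\in D_1: x\le a\}$ and $D_{(1)}:=\{x\in D_1: x\ge a\}$ are non-empty, the support of $h_{1,(0)}$ is contained in $D_{(0)}$, and the support of $h_{1,(1)}$ is contained in $D_{(1)}$; (D3) the integrals $I_1(h_{1,(0)})$ and $I_1(h_{1,(1)})$ are positive. Then the $N$-th minimal integration error in $F_d$ satisfies $$e(N,d)\ge(1-N\alpha^d)_+\,e(0,d),\qquad \alpha:=\frac{\max(I_1(h_{1,(0)}),I_1(h_{1,(1)}))}{I_1(h_{1,(0)})+I_1(h_{1,(1)})}\in\left[\tfrac12,1\right).$$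 Furthermore, the information complexity satisfies $$N(\varepsilon,d)\ge(1-\varepsilon)\left(\frac1\alpha\right)^d\quad\text{for all }\varepsilon\in(0,1)\text{ and }d\in\mathbb{N}.$$ In particular, the integration problem over $F_d$ suffers from the curse of dimensionality.
   Context: Notation: $\mathbb{N}=\{1,2,\dots\}$, $(x)_+=\max(x,0)$. Setting: $D_d=D_1\times\dots\times D_1$ ($d$-fold). $F_d=F_1\otimes\dots\otimes F_1$ ($d$-fold) is a tensor product space of functions on $D_d$, with a norm $\|\cdot\|_d$ that is a crossnorm, i.e. $\|f\|_d=\|f_1\|_1\cdots\|f_d\|_1$ for elementary tensors $f(x_1,\dots,x_d)=f_1(x_1)\cdots f_d(x_d)$. $F_d$ is not claimed to be uniquely determined by these requirements. Integration: $I_d(f)=\int_{D_d}f(\boldsymbol{x})\,\mathrm{d}\boldsymbol{x}$. Initial error: $e(0,d)=\sup\{|I_d(f)|: f\in F_d,\ \|f\|_d\le1\}$. A linear algorithm is $A_{d,N}(f)=\sum_{k=1}^N a_kf(\boldsymbol{x}_k)$ with nodes $\boldsymbol{x}_k\in D_d$ and weights $a_k\in\mathbb{R}$; its worst-case error is $e(F_d,A_{d,N})=\sup\{|I_d(f)-A_{d,N}(f)|: f\in F_d,\ \|f\|_d\le1\}$. The $N$-th minimal error $e(N,d)$ is the minimum of $e(F_d,A_{d,N})$ over all linear algorithms using $N$ nodes. Information complexity: $N(\varepsilon,d)=\min\{N\in\mathbb{N}: e(N,d)\le\varepsilon\,e(0,d)\}$. Curse of dimensionality: for some fixed $\varepsilon>0$,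 $N(\varepsilon,d)$ grows at least exponentially fast in $d$. Worst-case function: $h_1\in F_1$ with $e(0,1)=I_1(h_1/\|h_1\|_1)$. Standing assumption: for every $d$ the tensor product $h_d(\boldsymbol{x})=\prod_{j=1}^dh_1(x_j)$ is a worst-case function in $F_d$, i.e. $e(0,d)=I_d(h_d/\|h_d\|_d)$, hence $e(0,d)=e(0,1)^d$.
   Formalization: It is assumed in addition that h_{1,(0)} and h_{1,(1)} have disjoint supports, i.e. are not both nonzero at the common point x=a of D_(0) and D_(1); without this the claim fails, e.g. for the indicators of [0,1/2] and [1/2,1]. *)

(* Defs.v *)
From HB Require Import structures.
From mathcomp Require Import all_boot all_order all_algebra.
From mathcomp Require Import all_classical all_reals all_analysis.

Set Implicit Arguments.
Unset Strict Implicit.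
Unset Printing Implicit Defensive.

Import Order.TTheory GRing.Theory Num.Theory.
Import numFieldNormedType.Exports.

Local Open Scope classical_set_scope.
Local Open Scope ring_scope.

Section lebesgue_tuple.
Context {R : realType}.
Local Open Scope ereal_scope.

Definition cons_pair n (p : measurableTypeR R * n.-tuple (measurableTypeR R)) :
  n.+1.-tuple (measurableTypeR R) := [tuple of p.1 :: p.2].

Definition uncons n (t : n.+1.-tuple (measurableTypeR R)) :
    measurableTypeR R * n.-tuple (measurableTypeR R) :=
  (thead t, [tuple of behead t]).

Lemma cons_pairK n : cancel (@cons_pair n) (@uncons n).
Proof. by move=> [x t]; rewrite /uncons theadE; congr pair; apply/val_inj. Qed.

Lemma unconsK n : cancel (@uncons n) (@cons_pair n).
Proof. by move=> t; rewrite [RHS]tuple_eta; apply/val_inj. Qed.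

Lemma measurable_cons_pair n : measurable_fun setT (@cons_pair n).
Proof. exact: measurable_cons. Qed.

Lemma measurable_uncons n : measurable_fun setT (@uncons n).
Proof.
apply: measurable_fun_pair; last exact: measurable_behead.
exact: (measurable_tnth ord0).
Qed.

Section step.
Variables (n : nat)
  (m : {sigma_finite_measure set (n.-tuple (measurableTypeR R)) -> \bar R}).

Definition lebesgue_cons : set (n.+1.-tuple (measurableTypeR R)) -> \bar R :=
  pushforward (lebesgue_measure \x m) (@cons_pair n).

Let m' : {measure set _ -> \bar R} :=
  measure_function_pushforward__canonical__measure_function_Measure
    (lebesgue_measure \x m) (@measurable_cons_pair n).

Let lebesgue_cons0 : lebesgue_cons set0 = 0.
Proof. exact: (measure0 m'). Qed.

Let lebesgue_cons_ge0 A : 0 <= lebesgue_cons A.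
Proof. exact: (measure_ge0 m'). Qed.

Let lebesgue_cons_sigma_additive : semi_sigma_additive lebesgue_cons.
Proof. exact: (@measure_semi_sigma_additive _ _ _ m'). Qed.

HB.instance Definition _ := isMeasure.Build _ _ _ lebesgue_cons
  lebesgue_cons0 lebesgue_cons_ge0 lebesgue_cons_sigma_additive.

Lemma lebesgue_consE (A : set (measurableTypeR R))
    (B : set (n.-tuple (measurableTypeR R))) :
  measurable A -> measurable B ->
  lebesgue_cons (@uncons n @^-1` (A `*` B)) = lebesgue_measure A * m B.
Proof.
move=> mA mB; rewrite -product_measure1E// /lebesgue_cons /pushforward.
by rewrite -comp_preimage (_ : _ \o _ = id)//; apply/funext/cons_pairK.
Qed.

Let lebesgue_cons_sigma_finite : sigma_finite setT lebesgue_cons.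
Proof.
have /sigma_finiteP[F [TF ndF Foo]] :=
  sigma_finiteT (@lebesgue_measure R).
have /sigma_finiteP[G [TG ndG Goo]] := sigma_finiteT m.
exists (fun i => @uncons n @^-1` (F i `*` G i)).
  rewrite -preimage_bigcup -[LHS](preimage_setT (@uncons n)); congr preimage.
  rewrite -setXTT TF TG predeqE => -[x y]; split.
    move=> [/= [i _ Fix] [k _ Gky]]; exists (maxn i k) => //; split.
    - by move: x Fix; exact/subsetPset/ndF/leq_maxl.
    - by move: y Gky; exact/subsetPset/ndG/leq_maxr.
  by move=> [i _ []/= ? ?]; split; exists i.
move=> i; have [mF Fi] := Foo i; have [mG Gi] := Goo i; split.
  by rewrite -[X in measurable X]setTI; apply: measurable_uncons => //;
    exact: measurableX.
by rewrite lebesgue_consE// lte_mul_pinfty// ge0_fin_numE.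
Qed.

HB.instance Definition _ :=
  Measure_isSigmaFinite.Build _ _ _ lebesgue_cons lebesgue_cons_sigma_finite.

End step.

(* Lebesgue measure on the Borel sets of R^n, as an iterated product. *)
Fixpoint lebesgue_tuple n :
    {sigma_finite_measure set (n.-tuple (measurableTypeR R)) -> \bar R} :=
  match n with
  | 0 => \d_[tuple]
  | n.+1 => lebesgue_cons (lebesgue_tuple n)
  end.

Lemma lebesgue_tuple_box n (A : 'I_n -> set (measurableTypeR R)) :
  (forall i, measurable (A i)) ->
  lebesgue_tuple n [set t | forall i, A i (tnth t i)] =
  \prod_(i < n) lebesgue_measure (A i).
Proof.
elim: n A => [|n IH] A mA.
  rewrite big_ord0 [LHS]diracE mem_set//; first by move=> [].
have mbox : measurable [set t : n.-tuple (measurableTypeR R) |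
    forall i, A (lift ord0 i) (tnth t i)].
  rewrite (_ : mkset _ =
      \bigcap_(i : 'I_n) ((@tnth _ _)^~ i @^-1` A (lift ord0 i))).
    apply: fin_bigcap_measurable => // i _.
    by rewrite -[X in measurable X]setTI; exact: measurable_tnth.
  by apply/seteqP; split => t /= tA i => [_|]; apply: tA.
rewrite big_ord_recl -IH// -lebesgue_consE//=; congr lebesgue_cons.
have tnth_lift (t : n.+1.-tuple (measurableTypeR R)) i :
  tnth t (lift ord0 i) = tnth [tuple of behead t] i.
  by rewrite [in LHS](tuple_eta t) tnthS.
apply/seteqP; split => t /=.
  by move=> tA; split=> [|i]; [exact: tA|rewrite -tnth_lift; exact: tA].
move=> [t0 tA] i; have [j ->|->] := unliftP ord0 i; last exact: t0.
by rewrite tnth_lift; exact: tA.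
Qed.

End lebesgue_tuple.

(* A normed space of functions on D: the elements are those of an abstract
   normed module, and feval f is the function f represents. Only the values of
   feval f on D are meaningful: an element is determined by them, and every
   notion below refers to feval f on D only. *)
Record function_space {disp : measure_display} {T : measurableType disp}
    {R : realType} (mu : {measure set T -> \bar R}) (D : set T) :=
  FunctionSpace {
    carrier :> normedModType R ;
    feval : {linear carrier -> (T -> R^o)} ;
    feval_inj : forall f : carrier,
      (forall x, D x -> feval f x = 0) -> f = 0 ;
    feval_integrable : forall f : carrier,
      mu.-integrable D (fun x => (feval f x)%:E) }.

Arguments feval {disp T R mu D F} : rename.

Section function_space.
Context {disp : measure_display} {T : measurableType disp} {R : realType}.
Context {mu : {measure set T -> \bar R}} {D : set T}.
Variable F : function_space mu D.

(* The support is the set of points where f does not vanish, not its closure: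
   two functions may have disjoint supports that touch. For an inclusion in a
   relatively closed set, such as a half-line, this makes no difference. *)
Definition supp (f : F) : set T := [set x | D x /\ feval f x != 0].

Definition disjoint_supp (f g : F) : Prop := supp f `&` supp g = set0.

Definition q_property (q : \bar R) : Prop :=
  forall f g : F, disjoint_supp f g ->
    match q with
    | r%:E => `|f + g| `^ r = `|f| `^ r + `|g| `^ r
    | +oo%E => `|f + g| = Num.max `|f| `|g|
    | -oo%E => False
    end.

Definition integ (f : F) : R := \int[mu]_(x in D) (feval f x : R).

(* The errors are extended reals since nothing is assumed on the boundedness
   of integration and point evaluation on F. *)
Definition initial_error : \bar R :=
  ereal_sup [set `|integ f|%:E | f in [set f : F | `|f| <= 1]].

Definition worst_case_function (h : F) : Prop :=
  initial_error = (integ (`|h|^-1 *: h))%:E.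

Definition linear_algorithm N (a : 'I_N -> R) (x : 'I_N -> T) (f : F) : R :=
  \sum_(k < N) a k * feval f (x k).

Definition worst_case_error (A : F -> R) : \bar R :=
  ereal_sup [set `|integ f - A f|%:E | f in [set f : F | `|f| <= 1]].

(* The infimum over all N-point linear algorithms; it need not be attained. *)
Definition minimal_error N : \bar R :=
  ereal_inf [set e | exists (a : 'I_N -> R) (x : 'I_N -> T),
    (forall k, D (x k)) /\ e = worst_case_error (linear_algorithm a x)].

(* +oo when no number of nodes achieves the required error *)
Definition information_complexity (eps : R) : \bar R :=
  ereal_inf [set N%:R%:E | N in
    [set N : nat | (0 < N)%N /\ (minimal_error N <= eps%:E * initial_error)%E]].

End function_space.

Section tensor.
Context {R : realType}.
Variable D1 : set (measurableTypeR R).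

Definition cube d : set (d.-tuple (measurableTypeR R)) :=
  [set t | forall i, D1 (tnth t i)].

Definition univariate_space := function_space (@lebesgue_measure R) D1.

Definition multivariate_space d :=
  function_space (@lebesgue_tuple R d) (cube (d := d)).

Definition elementary_tensor (F1 : univariate_space) d
    (F : multivariate_space d) (f : 'I_d -> F1) (h : F) : Prop :=
  forall x, cube x ->
    feval h x = \prod_(i < d) feval (f i) (tnth x i).

(* The spaces F d, 0 < d, need not be spanned by the elementary tensors (in
   examples the closure, or a larger space, is taken); only for d = 1 is F d
   fully prescribed. F 0 plays no role. *)
Record tensor_product_spaces (F1 : univariate_space)
    (F : forall d, multivariate_space d) : Prop := {
  tensor_exists : forall d (f : 'I_d -> F1), (0 < d)%N ->
    exists h : F d, elementary_tensor f h ;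
  tensor_crossnorm : forall d (f : 'I_d -> F1) (h : F d), (0 < d)%N ->
    elementary_tensor f h -> `|h| = \prod_(i < d) `|f i| ;
  tensor_dim1 : forall h : F 1%N, exists f : F1,
    elementary_tensor (fun=> f) h }.

Definition curse_of_dimensionality (F : forall d, multivariate_space d) : Prop :=
  exists eps C b : R, [/\ 0 < eps, 0 < C, 1 < b &
    forall d, (0 < d)%N ->
      ((C * b ^+ d)%:E <= information_complexity (F d) eps)%E].

End tensor.

(* Main.v *)
(* Expanding h_d = (h_(0) + h_(1))^{\otimes d} gives 2^d elementary tensors with
   pairwise disjoint supports, each of integral at most
   alpha^d (I(h_(0)) + I(h_(1)))^d. The N nodes of an algorithm meet the supports
   of at most N of them; the sum f of the others vanishes at all nodes, so the
   algorithm cannot tell f from 0, while I(f) >= (1 - N alpha^d) I(h_d). Since f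
   and h_d - f have disjoint supports, the q-property gives |f| <= |h_d|, and f
   scaled by 1 / |h_d| witnesses the lower bound. *)

Require Import Defs.
From mathcomp Require Import all_boot all_order all_algebra.
From mathcomp Require Import all_classical all_reals all_analysis.
From mathcomp Require Import measurable_realfun.

Set Implicit Arguments.
Unset Strict Implicit.
Unset Printing Implicit Defensive.

Import Order.TTheory GRing.Theory Num.Theory.
Import numFieldNormedType.Exports.

Local Open Scope classical_set_scope.
Local Open Scope ring_scope.

(** * Fubini for products of functions of separate variables *)

Section product_integral.
Context {d1 d2 : measure_display} {T1 : measurableType d1}
  {T2 : measurableType d2} {R : realType}.
Variables (m1 : {sigma_finite_measure set T1 -> \bar R})
  (m2 : {sigma_finite_measure set T2 -> \bar R}) (g : T1 -> R) (h : T2 -> R).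
Hypotheses (ig : m1.-integrable setT (EFin \o g))
  (ih : m2.-integrable setT (EFin \o h)).
Local Open Scope ereal_scope.

Let mgh : measurable_fun setT (EFin \o (fun z : T1 * T2 => (g z.1 * h z.2)%R)).
Proof.
apply/measurable_EFinP; apply: measurable_funM; apply: measurableT_comp => //.
- by apply/measurable_EFinP; exact: measurable_int ig.
- by apply/measurable_EFinP; exact: measurable_int ih.
Qed.

(** By Tonelli, the iterated integral of the absolute value factors into two finite integrals. *)
Lemma integrable_prod_fun :
  (m1 \x m2).-integrable setT (fun z => (g z.1 * h z.2)%:E).
Proof.
apply/integrable12ltyP => //.
have hfin : \int[m2]_y `|(h y)%:E| \is a fin_num.
  by apply: integrable_fin_num; [exact: measurableT|exact: integrable_abse ih].
rewrite (eq_integral (fun x => `|(g x)%:E| * \int[m2]_y `|(h y)%:E|)).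
  rewrite -(fineK hfin) integralZr//; last exact: integrable_abse ig.
  have gfin : \int[m1]_x `|(g x)%:E| \is a fin_num.
    by apply: integrable_fin_num; [exact: measurableT|exact: integrable_abse ig].
  by rewrite -(fineK gfin) -EFinM ltry.
move=> x _ /=; rewrite -integralZl//; last exact: integrable_abse ih.
apply: eq_integral => y _.
by rewrite normrM EFinM.
Qed.

Lemma integral_prod_fun :
  \int[m1 \x m2]_z (g z.1 * h z.2)%:E =
  \int[m1]_x (g x)%:E * \int[m2]_y (h y)%:E.
Proof.
rewrite -integral12_prod_meas1//; last exact: integrable_prod_fun.
have hfin : \int[m2]_y (h y)%:E \is a fin_num by exact: integrable_fin_num.
rewrite (eq_integral (fun x => (g x)%:E * \int[m2]_y (h y)%:E)).
  by rewrite -(fineK hfin) integralZr.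
by move=> x _; rewrite /fubini_F -integralZl.
Qed.

End product_integral.

(** * Integrals of coordinatewise products over R^n *)

Section tuple_integral.
Context {R : realType}.
Local Open Scope ereal_scope.

(** Induction on [n], splitting off the first coordinate. Both claims are proved together because
    evaluating the integral for [n.+1] uses integrability of the product over the remaining [n]
    coordinates. *)
Lemma lebesgue_tuple_prod n (g : 'I_n -> measurableTypeR R -> R) :
  (forall i, (@lebesgue_measure R).-integrable setT (EFin \o g i)) ->
  (lebesgue_tuple n).-integrable setT
    (fun t => (\prod_(i < n) g i (tnth t i))%R%:E) /\
  \int[lebesgue_tuple n]_t (\prod_(i < n) g i (tnth t i))%R%:E =
    \prod_(i < n) \int[@lebesgue_measure R]_x (g i x)%:E.
Proof.
elim: n g => [|n IH] g ig.
  (* The base measure is the Dirac mass at the empty tuple, so the empty product has integral 1. *)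
  have -> : (fun t : 0.-tuple (measurableTypeR R) =>
      (\prod_(i < 0) g i (tnth t i))%R%:E) = cst 1.
    by apply/funext => t; rewrite big_ord0.
  split; first by apply/integrableP; split => //;
    rewrite integral_dirac//= diracT mul1e ?abse1 ?normr1 ltry.
  by rewrite big_ord0 integral_dirac//= diracT mul1e.
have [iG eG] := IH (fun i => g (lift ord0 i)) (fun i => ig _).
have mprod m (f : 'I_m -> measurableTypeR R -> R) :
    (forall i, (@lebesgue_measure R).-integrable setT (EFin \o f i)) ->
    measurable_fun setT
      (fun t : m.-tuple (measurableTypeR R) => (\prod_(i < m) f i (tnth t i))%:E).
  move=> fi; apply/measurable_EFinP; apply: measurable_prod => i _.
  apply: measurableT_comp; last exact: measurable_tnth.
  by apply/measurable_EFinP; exact: measurable_int (fi i).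
have gE : (fun t => (\prod_(i < n.+1) g i (tnth t i))%:E) \o @cons_pair R n =
    (fun z => (g ord0 z.1 * \prod_(i < n) g (lift ord0 i) (tnth z.2 i))%:E).
  apply/funext => -[x t] /=; rewrite big_ord_recl.
  by congr (_ * _)%:E; apply: eq_bigr => i _; rewrite tnthS.
have mc := @measurable_cons_pair R n.
have iP := integrable_prod_fun (ig ord0) iG.
have iP' : (lebesgue_measure \x lebesgue_tuple n).-integrable
   (@cons_pair R n @^-1` setT)
   ((fun t => (\prod_(i < n.+1) g i (tnth t i))%:E) \o @cons_pair R n).
  by rewrite gE preimage_setT.
split.
  exact: (integrable_pushforward mc (mprod _ _ ig) iP').
rewrite big_ord_recl -eG -integral_prod_fun//.
(* By definition the measure on [n.+1]-tuples is this pushforward; a change of variables then leads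
   back to the product measure. *)
transitivity (\int[pushforward (lebesgue_measure \x lebesgue_tuple n)
    (@cons_pair R n)]_t (\prod_(i < n.+1) g i (tnth t i))%:E); first by [].
by rewrite (integral_pushforward mc (mprod _ _ ig) iP')// preimage_setT gE.
Qed.

End tuple_integral.

(** * Fooling functions and error bounds in an abstract function space *)

Section function_space_theory.
Context {disp : measure_display} {T : measurableType disp} {R : realType}.
Context {mu : {measure set T -> \bar R}} {D : set T}.
Hypothesis mD : measurable D.
Variable F : function_space mu D.
Implicit Types f g : F.

Lemma fevalD f g x : feval (f + g) x = feval f x + feval g x.
Proof. by rewrite raddfD. Qed.

Lemma fevalZ (c : R) f x : feval (c *: f) x = c * feval f x.
Proof. by rewrite linearZ. Qed.

Lemma feval_sum (I : Type) (r : seq I) (P : pred I) (f : I -> F) x :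
  feval (\sum_(i <- r | P i) f i) x = \sum_(i <- r | P i) feval (f i) x.
Proof. by rewrite raddf_sum fct_sumE. Qed.

Lemma integD f g : integ (f + g) = integ f + integ g.
Proof.
rewrite /integ -RintegralD//; [|exact: feval_integrable..].
by apply: eq_Rintegral => x _; rewrite fevalD.
Qed.

Lemma integZ (c : R) f : integ (c *: f) = c * integ f.
Proof.
rewrite /integ -RintegralZl//; last exact: feval_integrable.
by apply: eq_Rintegral => x _; rewrite fevalZ.
Qed.

Lemma integ0 : integ (0 : F) = 0.
Proof. by rewrite -(scale0r 0) integZ mul0r. Qed.

Lemma integ_sum (I : Type) (r : seq I) (P : pred I) (f : I -> F) :
  integ (\sum_(i <- r | P i) f i) = \sum_(i <- r | P i) integ (f i).
Proof. exact: (big_morph _ integD integ0). Qed.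

Lemma linear_algorithm0 N (a : 'I_N -> R) (x : 'I_N -> T) f :
  (forall k, feval f (x k) = 0) -> linear_algorithm a x f = 0.
Proof.
by move=> fx0; rewrite /linear_algorithm big1// => k _; rewrite fx0 mulr0.
Qed.

(** A point where both partial sums are nonzero would lie in the supports of two [h i], [h j] with
    [P i] and [~~ P j], hence with distinct indices. *)
Lemma disjoint_supp_sum (I : finType) (h : I -> F) (P : pred I) :
  (forall i j, i != j -> disjoint_supp (h i) (h j)) ->
  disjoint_supp (\sum_(i | P i) h i) (\sum_(i | ~~ P i) h i).
Proof.
move=> dh; apply/seteqP; split => // x [[Dx + [_]]].
rewrite !feval_sum => hP hN.
have [i Pi hi0] : exists2 i, P i & feval (h i) x != 0.
  apply: contrapT => nh; move: hP; rewrite big1 ?eqxx// => k Pk.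
  by apply/eqP/negPn/negP => hk0; apply: nh; exists k.
have [j Nj hj0] : exists2 j, ~~ P j & feval (h j) x != 0.
  apply: contrapT => nh; move: hN; rewrite big1 ?eqxx// => k Pk.
  by apply/eqP/negPn/negP => hk0; apply: nh; exists k.
have ij : i != j by apply: contraNneq Nj => <-.
by have : set0 x by rewrite -(dh _ _ ij).
Qed.

(** For finite [q] the [q]-th powers of the norms compare, and [t ^ q] is strictly increasing on
    nonnegative reals. *)
Lemma q_property_norm_le q f g : (1%:E <= q)%E -> q_property F q ->
  disjoint_supp f g -> `|f| <= `|f + g|.
Proof.
move=> q1 Fq /Fq; case: q q1 {Fq} => [r| |]//.
- rewrite lee_fin => r1 fg; have r0 : 0 < r by exact: lt_le_trans r1.
  rewrite leNgt; apply/negP => /(gt0_ltr_powR r0); rewrite !nnegrE => /(_ _ _).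
  by rewrite fg ltNge lerDl powR_ge0 => /(_ (normr_ge0 _) (normr_ge0 _)).
- by move=> _ ->; rewrite le_max lexx.
Qed.

(** The rescaled function lies in the unit ball and is sent to 0 by [A], so its error is the
    absolute value of its integral. *)
Lemma worst_case_error_ge (A : F -> R) f (c : R) : 0 < c -> `|f| <= c ->
  A (c^-1 *: f) = 0 -> ((integ f / c)%:E <= worst_case_error A)%E.
Proof.
move=> c0 fc Af; apply: (@le_trans _ _ `|integ (c^-1 *: f) - A (c^-1 *: f)|%:E).
  by rewrite Af subr0 integZ lee_fin mulrC ler_norm.
apply: ereal_sup_ubound; exists (c^-1 *: f) => //=.
by rewrite normrZ gtr0_norm ?invr_gt0// mulrC ler_pdivrMr// mul1r.
Qed.

(* Each node lies in the support of at most one [h i], so at most [N] summands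
   are lost on restricting the sum to those which vanish at all nodes. *)
Lemma fooling_sum (I : finType) (h : I -> F) (M : R) N (x : 'I_N -> T) :
  (forall k, D (x k)) ->
  (forall i j, i != j -> disjoint_supp (h i) (h j)) ->
  0 <= M -> (forall i, integ (h i) <= M) ->
  exists P : pred I,
    (forall k, feval (\sum_(i | P i) h i) (x k) = 0) /\
    \sum_i integ (h i) - N%:R * M <= integ (\sum_(i | P i) h i).
Proof.
move=> Dx dh M0 hM.
(* The lost indices: those whose support contains a node. *)
pose K := [set i : I | [exists k, feval (h i) (x k) != 0]]%SET.
exists (fun i => i \notin K); split=> [k|].
  rewrite feval_sum big1// => i; rewrite inE negb_exists => /forallP/(_ k).
  by rewrite negbK => /eqP.
rewrite integ_sum (bigID (mem K))/= lerBlDr addrC lerD2l.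
apply: (@le_trans _ _ (\sum_(i in K) M)); first exact: ler_sum.
rewrite sumr_const -[leLHS]mulr_natl ler_wpM2r// ler_nat.
(* To get [#|K| <= N], each node is mapped to the index of a support containing it, if any. This map
   is option-valued, so [K] is compared with its image through [Some]. *)
rewrite -(card_imset _ (@Some_inj _)) -[leqRHS]card_ord.
pose p k := [pick i | feval (h i) (x k) != 0].
apply: leq_trans (leq_imset_card p 'I_N); apply/subset_leq_card/fintype.subsetP.
move=> _ /imsetP[i + ->]; rewrite inE => /existsP[k hik].
apply/imsetP; exists k => //; rewrite /p; case: pickP => [j hjk|/(_ i)]; last first.
  by rewrite hik.
congr Some; apply/eqP/negPn/negP => /dh dij.
by have : set0 (x k) by rewrite -dij; split; split.
Qed.

Lemma worst_case_functionE f : worst_case_function f ->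
  initial_error F = (integ f / `|f|)%:E.
Proof. by move=> ->; rewrite integZ mulrC. Qed.

Lemma integ_neq0_norm_gt0 f : integ f != 0 -> 0 < `|f|.
Proof.
by apply: contra_neqT; rewrite normr_gt0 negbK => /eqP ->; exact: integ0.
Qed.

Lemma minimal_error_ge (q : \bar R) (I : finType) (h : I -> F) (M : R) N :
  (1%:E <= q)%E -> q_property F q ->
  (forall i j, i != j -> disjoint_supp (h i) (h j)) ->
  0 <= M -> (forall i, integ (h i) <= M) ->
  0 < \sum_i integ (h i) -> worst_case_function (\sum_i h i) ->
  ((Num.max (1 - N%:R * (M / \sum_i integ (h i))) 0)%:E * initial_error F
    <= minimal_error F N)%E.
Proof.
move=> q1 Fq dh M0 hM h0 /worst_case_functionE ->.
set s := \sum_i integ (h i) in h0 *.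
have hn0 : 0 < `|\sum_i h i|.
  by apply: integ_neq0_norm_gt0; rewrite integ_sum gt_eqF.
apply: le_ereal_inf_tmp => _ [a [x [Dx ->]]]; rewrite -EFinM integ_sum -/s.
rewrite [X in X%:E]mulrA maxr_pMl ?(ltW h0)// mul0r mulrBl mul1r -mulrA
  divfK ?gt_eqF//.
have [P [P0 sP]] := fooling_sum Dx dh M0 hM.
(* If the positive part vanishes, the zero function already witnesses the bound; otherwise the
   fooling sum does. *)
have [sM|sM] := leP (s - N%:R * M) 0.
  rewrite mul0r; apply: le_trans (worst_case_error_ge (f := 0) hn0 _ _).
  - by rewrite integ0 mul0r.
  - by rewrite normr0 ltW.
  - by rewrite scaler0; apply: linear_algorithm0 => k; rewrite raddf0.
apply: le_trans (worst_case_error_ge (f := \sum_(i | P i) h i) hn0 _ _).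
- by rewrite lee_fin ler_pM2r ?invr_gt0.
- rewrite [X in _ <= `|X|](bigID P)/=; apply: (q_property_norm_le q1 Fq).
  exact: disjoint_supp_sum.
- by apply: linear_algorithm0 => k; rewrite fevalZ P0 mulr0.
Qed.

(** Cancelling [e0] gives [1 - N b <= eps] for every admissible [N]. If none is admissible, the
    infimum is [+oo] and the bound still holds. *)
Lemma information_complexity_ge (e0 b eps : R) : 0 < e0 -> 0 < b ->
  initial_error F = e0%:E ->
  (forall N, (0 < N)%N ->
    ((Num.max (1 - N%:R * b) 0)%:E * initial_error F <= minimal_error F N)%E) ->
  (((1 - eps) / b)%:E <= information_complexity F eps)%E.
Proof.
move=> e00 b0 eE eN; apply: le_ereal_inf_tmp => _ [N [N0 Neps] <-].
have := le_trans (eN N N0) Neps; rewrite eE -!EFinM !lee_fin ler_pM2r// ge_max.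
move=> /andP[Nb _]; rewrite ler_pdivrMr//.
by rewrite lerBlDr addrC -lerBlDr.
Qed.

End function_space_theory.

(** * Integrals of elementary tensors over the cube *)

Section tensor_theory.
Context {R : realType}.
Variable D1 : set (measurableTypeR R).
Hypothesis mD1 : measurable D1.

Lemma measurable_cube d : measurable (@cube R D1 d).
Proof.
rewrite (_ : @cube R D1 d = \bigcap_(i : 'I_d) ((@tnth _ _)^~ i @^-1` D1)).
  apply: fin_bigcap_measurable => // i _.
  by rewrite -[X in measurable X]setTI; exact: measurable_tnth.
by apply/seteqP; split => t /= tD i => [_|]; apply: tD.
Qed.

(** Extending each factor by zero outside [D1] turns the integral over the cube into one over all
    tuples, where Fubini applies. *)
Lemma integ_elementary_tensor (F1 : univariate_space D1) d
    (F : multivariate_space D1 d) (f : 'I_d -> F1) (h : F) :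
  elementary_tensor f h -> integ h = \prod_(i < d) integ (f i).
Proof.
move=> fh; pose g i : measurableTypeR R -> R := (feval (f i) : _ -> R) \_ D1.
have gint i : (@lebesgue_measure R).-integrable setT (EFin \o g i).
  rewrite /g -restrict_EFin; apply/(integrable_mkcond _ mD1).
  exact: feval_integrable.
have [_ gE] := lebesgue_tuple_prod gint.
rewrite /integ Rintegral_mkcond /Rintegral.
rewrite (eq_integral (fun t => (\prod_(i < d) g i (tnth t i))%:E)); last first.
  move=> t _; congr EFin; rewrite /patch; case: ifPn => [|tD].
    rewrite inE => tD; rewrite fh//; apply: eq_bigr => i _.
    by rewrite /g patchT// inE; exact: tD.
  (* Outside the cube some coordinate leaves [D1], and the corresponding extended factor is zero. *)
  apply/esym/eqP; apply: contraNT tD => /prodf_neq0 tD.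
  rewrite inE => i; apply: contrapT => tiD; move: (tD i isT).
  by rewrite /g patchN ?eqxx// notin_setE.
rewrite gE.
have -> : (\prod_(i < d) \int[@lebesgue_measure R]_x (g i x)%:E)%E =
    (\prod_(i < d) (\int[@lebesgue_measure R]_(x in D1) (feval (f i) x : R))%R)%:E.
  rewrite -prodEFin; apply: eq_bigr => i _; rewrite Rintegral_mkcond fineK//.
  by apply: integrable_fin_num => //; exact: gint.
by [].
Qed.

End tensor_theory.

(** * Expansion of a tensor power of a two-piece function; [s] records the piece used in each
    coordinate *)

Section split_tensor.
Context {R : realType}.
Variable D1 : set (measurableTypeR R).
Hypothesis mD1 : measurable D1.
Variables (F1 : univariate_space D1) (d : nat) (F : multivariate_space D1 d).
Variables (u : bool -> F1) (h : {ffun 'I_d -> bool} -> F).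
Hypothesis hu : forall s : {ffun 'I_d -> bool},
  elementary_tensor (fun i => u (s i)) (h s).

(** At a coordinate where [s] and [t] differ, a common support point would have an entry in the
    supports of both pieces. *)
Lemma disjoint_supp_split_tensor s t : disjoint_supp (u false) (u true) ->
  s != t -> disjoint_supp (h s) (h t).
Proof.
move=> du st; apply/seteqP; split => // x [[Dx hs] [_ ht]].
have {st} [i sti] : exists i, s i != t i.
  by apply/existsP; apply: contraNT st => /existsPn st; apply/eqP/ffunP => i;
    apply/eqP/negPn.
move: hs ht; rewrite !hu// => /prodf_neq0/(_ i isT) si /prodf_neq0/(_ i isT) ti.
suff : set0 (tnth x i) by [].
rewrite -du; move: sti si ti; case: (s i); case: (t i) => // _ si ti;
  by split; split => //; exact: Dx.
Qed.

(** Distributivity: a product over coordinates of two-term sums expands into a sum over all choices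
    [s]. *)
Lemma split_tensor_sum (g : F1) :
  (forall x, D1 x -> feval g x = feval (u false) x + feval (u true) x) ->
  elementary_tensor (fun=> g) (\sum_s h s).
Proof.
move=> gu x Dx; rewrite feval_sum.
under eq_bigr => s _ do rewrite hu//.
rewrite -(bigA_distr_bigA (fun i b => feval (u b) (tnth x i))).
by apply: eq_bigr => i _; rewrite big_bool gu 1?addrC//; exact: Dx.
Qed.

Lemma integ_split_tensor_sum :
  \sum_s integ (h s) = (integ (u false) + integ (u true)) ^+ d.
Proof.
under eq_bigr => s _ do rewrite (integ_elementary_tensor mD1 (hu s)).
rewrite -(bigA_distr_bigA (fun _ b => integ (u b))) prodr_const card_ord.
by rewrite big_bool addrC.
Qed.

Lemma integ_split_tensor_le s : (forall b, 0 <= integ (u b)) ->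
  integ (h s) <= Num.max (integ (u false)) (integ (u true)) ^+ d.
Proof.
move=> u0; rewrite (integ_elementary_tensor mD1 (hu s)).
rewrite -[X in _ ^+ X]card_ord -prodr_const; apply: ler_prod => i _.
by rewrite u0/= le_max; case: (s i); rewrite lexx ?orbT.
Qed.

End split_tensor.

Theorem theorem2 (R : realType)
  (D1 : set (measurableTypeR R)) (D1_borel : measurable D1)
  (F1 : univariate_space D1) (F : forall d : nat, multivariate_space D1 d)
  (F_tensor : tensor_product_spaces F1 F)
  (q : \bar R) (q_ge1 : (1%:E <= q)%E)
  (F_q : forall d : nat, (0 < d)%N -> q_property (F d) q)
  (h1 h10 h11 : F1)
  (h1_worst : worst_case_function h1)
  (h_worst : forall (d : nat) (h : F d), (0 < d)%N ->
    elementary_tensor (fun=> h1) h -> worst_case_function h)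
  (h1_decomp : forall x, D1 x -> feval h1 x = feval h10 x + feval h11 x)
  (a : R)
  (D10_neq0 : [set x | D1 x /\ x <= a] !=set0)
  (D11_neq0 : [set x | D1 x /\ a <= x] !=set0)
  (supp_h10 : supp h10 `<=` [set x | D1 x /\ x <= a])
  (supp_h11 : supp h11 `<=` [set x | D1 x /\ a <= x])
  (supp_disj : disjoint_supp h10 h11)
  (h10_pos : 0 < integ h10) (h11_pos : 0 < integ h11) :
  let alpha := Num.max (integ h10) (integ h11) / (integ h10 + integ h11) in
  [/\ 1 / 2 <= alpha < 1,
      forall N d : nat, (0 < N)%N -> (0 < d)%N ->
        ((Num.max (1 - N%:R * alpha ^+ d) 0)%:E * initial_error (F d)
          <= minimal_error (F d) N)%E,
      forall (eps : R) (d : nat), 0 < eps < 1 -> (0 < d)%N ->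
        (((1 - eps) * (1 / alpha) ^+ d)%:E
          <= information_complexity (F d) eps)%E &
      curse_of_dimensionality F].
Proof.
move=> alpha.
set I0 := integ h10 in h10_pos alpha *; set I1 := integ h11 in h11_pos alpha *.
have s0 : 0 < I0 + I1 by exact: addr_gt0.
have m0 : 0 < Num.max I0 I1 by rewrite lt_max h10_pos.
have a0 : 0 < alpha by exact: divr_gt0.
have a1 : alpha < 1.
  by rewrite ltr_pdivrMr// mul1r gt_max ltrDl ltrDr h10_pos h11_pos.
have a2 : 1 / 2 <= alpha.
  rewrite ler_pdivrMr// mulrAC ler_pdivlMr// mul1r mulr_natr mulr2n.
  by apply: lerD; rewrite le_max lexx ?orbT.
(* Positivity and finiteness of the initial error are recorded along with the bound, since the
   complexity estimate divides by it. *)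
have H d : (0 < d)%N -> exists2 e0 : R, 0 < e0 & initial_error (F d) = e0%:E /\
    forall N, ((Num.max (1 - N%:R * alpha ^+ d) 0)%:E * initial_error (F d)
      <= minimal_error (F d) N)%E.
  move=> d0; pose u b := if b then h11 else h10.
  (* Tensors are only known to exist, so one is chosen for each [s]. *)
  have [h hu] := choice (fun s : {ffun 'I_d -> bool} =>
    tensor_exists F_tensor (fun i => u (s i)) d0).
  have mcube := @measurable_cube R D1 D1_borel d.
  have sE := integ_split_tensor_sum D1_borel hu.
  have sh0 : 0 < \sum_s integ (h s) by rewrite sE exprn_gt0.
  have hw := h_worst _ _ d0 (split_tensor_sum hu h1_decomp).
  have iE := worst_case_functionE mcube hw.
  exists (integ (\sum_s h s) / `|\sum_s h s|).
    rewrite divr_gt0 ?integ_sum//; apply: (integ_neq0_norm_gt0 mcube).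
    by rewrite integ_sum// gt_eqF.
  split=> // N.
  (* With [M] the [d]-th power of the larger integral and total integral [(I0 + I1) ^+ d], the ratio
     is exactly [alpha ^+ d]. *)
  have := @minimal_error_ge _ _ _ _ _ mcube (F d) q _ h (Num.max I0 I1 ^+ d) N
    q_ge1 (F_q _ d0) (fun s t => disjoint_supp_split_tensor hu supp_disj).
  rewrite sE -expr_div_n; apply => //; first by rewrite exprn_ge0// ltW.
  - by move=> s; apply: (integ_split_tensor_le D1_borel hu) => -[]; exact: ltW.
  - by rewrite exprn_gt0.
have C (eps : R) d : (0 < d)%N ->
    (((1 - eps) * (1 / alpha) ^+ d)%:E <= information_complexity (F d) eps)%E.
  move=> d0; have [e0 e00 [eE eN]] := H _ d0.
  rewrite div1r exprVn;
    apply: (information_complexity_ge eps e00 _ eE) => [|N _].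
    exact: exprn_gt0.
  exact: eN.
split.
- by rewrite a2 a1.
- by move=> N d _ /H[_ _ [_]].
- by move=> eps d _; exact: C.
(* For [eps = 1 / 2] the prefactor [1 - eps] is again [1 / 2], and the base [1 / alpha] exceeds
   1. *)
- exists (1 / 2), (1 / 2), (1 / alpha); split=> //; try exact: divr_gt0.
    by rewrite ltr_pdivlMr// mul1r.
  move=> d d0; have := C (1 / 2) d d0.
  by rewrite [X in X * _](_ : _ = 1 / 2)// {1}(splitr 1) addrK.
Qed.
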